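(* There exist real constants $c_0$ and $c_1>0$ such that for every large number $x\geq 2$, $$\pi(x)\geq c_1\log x+c_0 .$$
   Context: For a real number $x\ge 1$, $\pi(x)=\#\{p\leq x : p \text{ is prime}\}$ is the prime counting function, and $\log$ is the natural logarithm. *)

(* Defs.v *)
From mathcomp Require Import all_boot all_order all_algebra finmap.
From mathcomp Require Import all_classical all_reals all_analysis.

Set Implicit Arguments.
Unset Strict Implicit.
Unset Printing Implicit Defensive.

Import Order.TTheory GRing.Theory Num.Theory.

Local Open Scope classical_set_scope.
Local Open Scope ring_scope.

Definition primes_le {R : realType} (x : R) : set nat :=
  [set p : nat | prime p /\ p%:R <= x].

(* [fset_set] returns the empty set on infinite sets; [finite_primes_le] shows
   that this default case does not occur. *)
Definition prime_counting {R : realType} (x : R) : nat :=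
  #|` fset_set (primes_le x) |.

Lemma finite_primes_le {R : realType} (x : R) : finite_set (primes_le x).
Proof.
apply: (@sub_finite_set _ _ `I_(Num.truncn x).+1); last exact: finite_II.
move=> p [_ px] /=; rewrite ltnS truncn_ge_nat//.
exact: le_trans px.
Qed.

(* Main.v *)
Require Import Defs.
From mathcomp Require Import all_boot all_order all_algebra finmap.
From mathcomp Require Import all_classical all_reals all_analysis.

(** Erdős' argument: a positive integer factors as [s ^ 2 * t] with [t]
    squarefree. If the integer is at most [n], then [s] is at most the square
    root of [n], and [t] is the product of a set of primes up to [n], so there
    are at most [2 ^ k] choices for [t], where [k] counts those primes. Hence
    [n <= 2 ^ k * sqrt n], that is [n <= 4 ^ k] ([leq_exp4_card_primes]).
    For [n] the integer part of [x >= 2] this yields [x <= 2 * 4 ^ k], and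
    taking logarithms gives the bound with [c1 = 1 / ln 4] and
    [c0 = - ln 2 / ln 4]. *)

Import Order.TTheory GRing.Theory Num.Theory.

Local Open Scope nat_scope.

Definition primes_upto (n : nat) : {set 'I_n.+1} := [set p : 'I_n.+1 | prime p].

(** The parity of each exponent in the prime factorization decides which primes
    enter the squarefree factor; the halved exponents give the square root. *)
Lemma square_squarefree_decomposition (n m : nat) : 0 < m <= n ->
  exists2 A : {set 'I_n.+1}, A \subset primes_upto n &
    exists2 s, 0 < s & m = s ^ 2 * \prod_(p in A) p.
Proof.
move=> /andP[m_gt0 le_mn].
exists [set p in primes_upto n | odd (logn p m)].
  by apply/fintype.subsetP => p; rewrite inE => /andP[].
exists (\prod_(p in primes_upto n) p ^ (logn p m)./2).
  by apply: prodn_cond_gt0 => p; rewrite inE => pp; rewrite expn_gt0 prime_gt0.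
have {1}-> : m = \prod_(p in primes_upto n) p ^ logn p m.
  rewrite -{1}(partnT m_gt0) (@widen_partn n) // big_mkord.
  rewrite [RHS]big_mkcond; apply: eq_bigr => p _; rewrite inE.
  by case: ifP => // npp; rewrite lognE npp.
(* The product over [A] becomes a product over all primes, [A] surviving only
   as the exponent [odd (logn p m)]. *)
have -> : \prod_(p in [set p in primes_upto n | odd (logn p m)]) val p
        = \prod_(p in primes_upto n) p ^ odd (logn p m).
  rewrite big_mkcond [RHS]big_mkcond; apply: eq_bigr => p _.
  by rewrite !inE; case: prime => //=; case: odd.
rewrite -mulnn -!big_split; apply: eq_bigr => p _ /=.
by rewrite -!expnD addnn addnC odd_double_half.
Qed.

Lemma sqrt_floor (n : nat) : exists2 r, r ^ 2 <= n & n < r.+1 ^ 2.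
Proof.
have ex0 : exists r, r ^ 2 <= n by exists 0.
have bound r : r ^ 2 <= n -> r <= n.
  by apply: leq_trans; case: r => // r; rewrite -mulnn leq_pmulr.
case: (ex_maxnP ex0 bound) => r le_rn max_r; exists r => //.
by rewrite ltnNge; apply/negP => /max_r; rewrite ltnn.
Qed.

(** The pairs (set of primes, square root) are mapped onto the integers from
    1 to [n], so there are at least [n] of them. *)
Lemma leq_card_pairs (n r : nat) : n < r.+1 ^ 2 ->
  n <= 2 ^ #|primes_upto n| * r.
Proof.
move=> lt_nr.
pose f (u : {set 'I_n.+1} * 'I_r) : 'I_n.+1 :=
  inord (u.2.+1 ^ 2 * \prod_(p in u.1) p).
pose D : {set {set 'I_n.+1} * 'I_r} :=
  finset.setX (powerset (primes_upto n)) [set: 'I_r].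
have <- : #|D| = 2 ^ #|primes_upto n| * r.
  by rewrite cardsX card_powerset cardsT card_ord.
suff sub : [set~ ord0 : 'I_n.+1] \subset f @: D.
  have := leq_trans (subset_leq_card sub) (leq_imset_card f D).
  by rewrite cardsC1 card_ord.
apply/fintype.subsetP => m; rewrite !inE -val_eqE /= => m_neq0.
have m_range : 0 < m <= n by rewrite lt0n m_neq0 -ltnS ltn_ord.
have [A subA [s s_gt0 def_m]] := square_squarefree_decomposition _ _ m_range.
have s_sq : s ^ 2 <= n.
  apply: (@leq_trans m); last by case/andP: m_range.
  rewrite {1}def_m leq_pmulr // prodn_cond_gt0 // => p pA.
  by move/fintype.subsetP/(_ _ pA): subA; rewrite inE => /prime_gt0.
have lt_sr : s.-1 < r.
  by rewrite -ltnS prednK // -(ltn_sqr s r.+1) (leq_ltn_trans s_sq).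
apply/imsetP; exists (A, Ordinal lt_sr); first by rewrite !inE subA.
by apply: val_inj; rewrite /f /= prednK // -def_m inordK.
Qed.

Lemma leq_exp4_card_primes (n : nat) : n <= 4 ^ #|primes_upto n|.
Proof.
case: n => // n; set k := #|_|.
have [r le_rn lt_nr] := sqrt_floor n.+1.
have le_n : n.+1 <= 2 ^ k * r by exact: leq_card_pairs.
rewrite -(@leq_pmul2r n.+1) // mulnn.
apply: (@leq_trans ((2 ^ k * r) ^ 2)); first by rewrite leq_sqr.
by rewrite expnMn expnAC leq_mul2l le_rn orbT.
Qed.

Local Open Scope ring_scope.

Lemma prime_countingE (R : realType) (x : R) : 0 <= x ->
  prime_counting x = #|primes_upto (Num.truncn x)|.
Proof.
move=> x_ge0; rewrite /prime_counting.
have -> : fset_set (primes_le x)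
        = [fset val p | p in primes_upto (Num.truncn x)]%fset.
  apply/fsetP => p; rewrite in_fset_set; last exact: finite_primes_le.
  apply/idP/imfsetP => /= [|[q]].
    rewrite inE => -[pp le_px].
    have lt_p : (p < (Num.truncn x).+1)%N by rewrite ltnS truncn_ge_nat.
    by exists (Ordinal lt_p); rewrite ?inE.
  rewrite inE => pq ->; split; first by move: pq; rewrite inE.
  by rewrite -truncn_ge_nat // -ltnS.
by rewrite card_imfset /=; [rewrite -cardE | exact: val_inj].
Qed.

Theorem theorem2p1 (R : realType) :
  exists c0 c1 : R, 0 < c1 /\
    forall x : R, 2 <= x -> c1 * ln x + c0 <= (prime_counting x)%:R.
Proof.
have ln4_gt0 : 0 < ln (4 : R) by rewrite ln_gt0 // ltr1n.
exists (- (ln 2 / ln 4)), (ln 4)^-1; split; first by rewrite invr_gt0.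
move=> x x_ge2.
have x_gt0 : 0 < x by exact: lt_le_trans x_ge2.
have x_ge0 : 0 <= x by exact: ltW.
rewrite prime_countingE //; set n := Num.truncn x; set k := #|_|.
have n_gt0 : (0 < n)%N.
  by rewrite truncn_ge_nat //; apply: le_trans x_ge2; rewrite ler1n.
(* [x < n + 1 <= 2 * n], and [n] is at most [4 ^ k]. *)
have le_x : x <= 2 * 4 ^+ k.
  apply: (@le_trans _ _ n.+1%:R); first exact/ltW/truncnS_gt.
  rewrite -natrX -natrM ler_nat.
  apply: (@leq_trans (2 * n)%N); first by rewrite mul2n -addnn -addn1 leq_add2l.
  by rewrite leq_mul2l leq_exp4_card_primes.
rewrite mulrC -mulrBl ler_pdivrMr // lerBlDl mulr_natl -lnXn // -lnM ?posrE //.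
by rewrite ler_ln // posrE mulr_gt0 // exprn_gt0.
Qed.
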